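(* Let $\kappa,\lambda$ be cardinals with $\omega_1 \le \kappa \le \lambda \le 2^{\omega}$, and assume the ideal $\mathcal{N}$ of null subsets of the Cantor space $2^\omega$ is $(\kappa,\lambda)$-nicely generated. Then $\kappa=\lambda$.
   Context: $2^\omega$ carries the product measure, where each factor $2=\{0,1\}$ gives each point measure $1/2$; $\mathcal{N}$ is the ideal of measure-zero sets. For a set $X$, cardinals $\kappa\le\lambda\le|X|$, and an ideal $\mathcal{I}\subseteq P(X)$ (with $\bigcup\mathcal{I}=X$ and $X\notin\mathcal{I}$), $\mathcal{I}$ is called $(\kappa,\lambda)$-nicely generated if there is a partition $\langle X_\alpha : \alpha<\lambda\rangle$ of $X$ with each $X_\alpha\in\mathcal{I}$ such that (i) $\bigcup_{\alpha\in\Delta}X_\alpha\in\mathcal{I}$ for every $\Delta\subseteq\lambda$ with $|\Delta|<\kappa$, and (ii) for every $Y\in\mathcal{I}$ there is $\Delta\subseteq\lambda$ with $|\Delta|<\kappa$ and $Y\subseteq\bigcup_{\alpha\in\Delta}X_\alpha$. *)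

(* Defs.v *)
From mathcomp Require Import all_boot all_order all_algebra.
From mathcomp Require Import finmap.
From mathcomp Require Import all_classical all_reals all_analysis.

Set Implicit Arguments.
Unset Strict Implicit.
Unset Printing Implicit Defensive.

Import Order.TTheory GRing.Theory Num.Theory.

Local Open Scope classical_set_scope.
Local Open Scope card_scope.
Local Open Scope ring_scope.

(* A cardinal is represented by any type [K] of that cardinality; cardinals   *)
(* are compared through [#<=] and [#=] on [set: K].                           *)

Definition card_lt (T U : Type) (A : set T) (B : set U) : Prop :=
  A #<= B /\ ~ (B #<= A).

Definition is_omega1 (W : Type) : Prop :=
  card_lt [set: nat] [set: W] /\
  forall V : Type, card_lt [set: nat] [set: V] -> [set: W] #<= [set: V].

(* [K] and [L] stand for kappa and lambda. The library's [partition] requires *)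
(* the blocks to be nonempty, so there are exactly lambda of them.            *)
Definition nicely_generated (X K L : Type) (I : set (set X)) : Prop :=
  exists F : L -> set X,
    [/\ partition [set: L] F [set: X],
        forall a, I (F a),
        forall D : set L, card_lt D [set: K] -> I (\bigcup_(a in D) F a)
      & forall Y : set X, I Y ->
          exists2 D : set L, card_lt D [set: K] & Y `<=` \bigcup_(a in D) F a].
Arguments nicely_generated {X} K L I.

Definition coordinate_sets : set (set cantor_space) :=
  [set A | exists (n : nat) (b : bool), A = [set x | x n = b]].

(* The Cantor space with the product sigma-algebra. *)
Notation cantor_meas := (g_sigma_algebraType coordinate_sets).

(* [mu] is the product of the measures giving mass 1/2 to each point of       *)
(* {0, 1}: the cylinder fixing the coordinates in a finite set [J] has mass   *)
(* (1/2)^|J|. This determines [mu], as the cylinders form a pi-system         *)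
(* generating the product sigma-algebra.                                      *)
Definition is_product_measure (R : realType)
    (mu : {measure set cantor_meas -> \bar R}) : Prop :=
  forall (J : {fset nat}) (s : nat -> bool),
    mu [set x : cantor_meas | forall i, i \in J -> x i = s i] =
      ((2^-1 : R) ^+ #|` J|)%:E.

Definition null_ideal (R : realType)
    (mu : {measure set cantor_meas -> \bar R}) : set (set cantor_space) :=
  [set A | mu.-negligible A].

(* Main.v *)
(** Let [block x] be the index of the block of [x]; a set is null exactly when it
meets fewer than kappa blocks. If kappa < lambda, then [2^omega] is not a union
of kappa null sets, since these meet at most kappa * kappa = kappa blocks.
Identify [2^omega] with its square by interleaving, a measure-preserving
bijection under which every horizontal and every vertical line is null. For a
line [w], the saturation of the line is null, so by Fubini almost every line [z]
is almost disjoint from [w]: the set of [t] at which the points of [z] and [w] at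
height [t] share a block is null. Take a maximal set [W] of pairwise almost
disjoint lines. By maximality [2^omega] is a union of [#|W|] null sets, so [W]
contains kappa lines; and some height [t] avoids the kappa null sets attached to
pairs of these, so that the transversal line at height [t], although null, meets
kappa blocks. *)

From HB Require Import structures.
Require Import Defs.
From mathcomp Require Import all_boot all_order all_algebra.
From mathcomp Require Import finmap.
From mathcomp Require Import all_classical all_reals all_analysis.

Import Order.TTheory GRing.Theory Num.Theory.

Local Open Scope classical_set_scope.
Local Open Scope card_scope.
Local Open Scope ring_scope.

(** * Comparison of cardinalities *)

(** Choice selects one related point for each [x]. The relation may be multivalued, which suits
    graphs given by Zorn's lemma and families of overlapping sets. *)
Lemma card_le_of_rel {T U : Type} (A : set T) (B : set U) (r : T -> U -> Prop) :
  (forall x, A x -> exists2 y, B y & r x y) ->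
  (forall x y z, A x -> A y -> r x z -> r y z -> x = y) -> A #<= B.
Proof.
move=> tot inj; apply/card_leP/injfunPex.
have e (x : A) : exists y : B, r (val x) (val y).
  have [y By rxy] := tot _ (set_valP x).
  by exists (SigSub (mem_set By)).
have [g gP] := choice e.
exists g => // x y _ _ gxy; apply: val_inj.
apply: (inj _ _ (val (g x))); [exact: set_valP|exact: set_valP|exact: gP|].
by rewrite gxy; exact: gP.
Qed.

Lemma card_le_of_inj {T U : Type} (A : set T) (B : set U) (f : T -> U) :
  (forall x, A x -> B (f x)) ->
  (forall x y, A x -> A y -> f x = f y -> x = y) -> A #<= B.
Proof.
move=> fAB finj.
by apply: (@card_le_of_rel _ _ _ _ (fun x y => y = f x))
    => [x Ax|x y z Ax Ay -> /finj];
  [exists (f x) => //; exact: fAB | exact].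
Qed.

(** Turns an embedding into a function on the whole type, with the default value [u] outside [A]. *)
Lemma card_le_injP {T U : Type} {A : set T} {B : set U} (u : U) : A #<= B ->
  exists f : T -> U, (forall x, A x -> B (f x)) /\
    (forall x y, A x -> A y -> f x = f y -> x = y).
Proof.
move=> /card_leP/injfunPex[g _ ginj].
exists (fun x => if pselect (A x) is left Ax
  then val (g (SigSub (mem_set Ax))) else u).
split=> [x Ax|x y Ax Ay].
  by case: pselect => // Ax'; exact: set_valP.
case: pselect => // Ax'; case: pselect => // Ay' /val_inj /ginj e.
by have /(congr1 val) := e (in_setT _) (in_setT _).
Qed.

Lemma card_le_nonempty {T U : Type} {B : set U} (x : T) : [set: T] #<= B -> B !=set0.
Proof.
by move=> /card_leP[g]; exists (val (g (SigSub (mem_set (I : [set: T] x)))));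
  exact: set_valP.
Qed.

(** Zorn's lemma gives a maximal graph of a partial injection from [A] to [B]. If it missed both a
    point of [A] and a point of [B], this pair could be added to it. *)
Lemma card_le_total {T U : Type} (A : set T) (B : set U) : A #<= B \/ B #<= A.
Proof.
pose P (G : set (T * U)) := [/\ forall p, G p -> A p.1 /\ B p.2,
   forall p q, G p -> G q -> p.1 = q.1 -> p = q &
   forall p q, G p -> G q -> p.2 = q.2 -> p = q].
have [F FP Ftot|G [[GAB G1 G2] Gmax]] := @Zorn_bigcup _ P.
  have common p q : (\bigcup_(X in F) X) p -> (\bigcup_(X in F) X) q ->
      exists X, [/\ F X, X p & X q].
    move=> [X FX Xp] [Y FY Yq]; have [XY|YX] := Ftot _ _ FX FY.
      by exists Y; split => //; exact: XY.
    by exists X; split => //; exact: YX.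
  split=> [p [X FX Xp]|p q Fp Fq|p q Fp Fq].
  - by have [+ _ _] := FP _ FX; exact.
  - by have [X [FX Xp Xq]] := common _ _ Fp Fq; have [_ + _] := FP _ FX; exact.
  - by have [X [FX Xp Xq]] := common _ _ Fp Fq; have [_ _] := FP _ FX; exact.
have [tA|/existsNP[a /not_implyP[Aa aG]]] :=
    pselect (forall x, A x -> exists y, G (x, y)).
  left; apply: (@card_le_of_rel _ _ _ _ (fun x y => G (x, y))).
    by move=> x /tA[y Gxy]; exists y => //; have [] := GAB _ Gxy.
  by move=> x y z _ _ Gx Gy; have [] := G2 _ _ Gx Gy erefl.
have [tB|/existsNP[b /not_implyP[Bb bG]]] :=
    pselect (forall y, B y -> exists x, G (x, y)).
  right; apply: (@card_le_of_rel _ _ _ _ (fun y x => G (x, y))).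
    by move=> y /tB[x Gxy]; exists x => //; have [] := GAB _ Gxy.
  by move=> x y z _ _ Gx Gy; have [] := G1 _ _ Gx Gy erefl.
exfalso; apply: (Gmax (G `|` [set (a, b)])).
  split; first exact: subsetUl.
  by move=> /(_ (a, b)) h; apply: aG; exists b; apply: h; right.
split=> [p [/GAB//|->//]|p q|p q].
- move=> [Gp|->] [Gq|->] //=; first exact: G1.
    by case: p Gp => x y /= + xa; rewrite xa => Gxy; case: aG; exists y.
  by case: q Gq => x y /= + xa; rewrite -xa => Gxy; case: aG; exists y.
- move=> [Gp|->] [Gq|->] //=; first exact: G2.
    by case: p Gp => x y /= + xa; rewrite xa => Gxy; case: bG; exists x.
  by case: q Gq => x y /= + xa; rewrite -xa => Gxy; case: bG; exists x.
Qed.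

(** * Squares of infinite cardinals, and unions *)

Section Square.
Variable K : Type.

Let dom (G : set (K * K * K)) := [set x | exists y z, G (x, y, z)].

(* [G] is the graph of an injective, possibly multivalued, binary operation on
   [dom G]. *)
Let good (G : set (K * K * K)) :=
  [/\ forall x y, dom G x -> dom G y -> exists z, G (x, y, z),
      forall x y z, G (x, y, z) -> dom G y /\ dom G z &
      forall p q z, G (p, z) -> G (q, z) -> p = q].

Let good_bigcup (F : set (set (K * K * K))) :
  F `<=` good -> total_on F subset -> good (\bigcup_(X in F) X).
Proof.
move=> FP Ftot.
have domF X : F X -> dom X `<=` dom (\bigcup_(X in F) X).
  by move=> FX x [y [z Xxyz]]; exists y, z, X.
(* Two points of a union over a chain lie in a single member; [f] is either [dom] or the
   identity. *)
have common T (p q : T) (f : set (K * K * K) -> set T) :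
  (forall X Y, X `<=` Y -> f X `<=` f Y) ->
  (exists2 X, F X & f X p) -> (exists2 X, F X & f X q) ->
    exists X, [/\ F X, f X p & f X q].
  move=> fmono [X FX Xp] [Y FY Yq]; have [XY|YX] := Ftot _ _ FX FY.
    by exists Y; split => //; exact: (fmono X Y).
  by exists X; split => //; exact: (fmono Y X).
split.
- move=> x y [x1 [x2 [X FX Xx]]] [y1 [y2 [Y FY Yy]]].
  have [|||Z [FZ Zx Zy]] := common _ x y dom.
  + by move=> ? ? sub a [b [c /sub ?]]; exists b, c.
  + by exists X => //; exists x1, x2.
  + by exists Y => //; exists y1, y2.
  have [+ _ _] := FP _ FZ => /(_ _ _ Zx Zy)[z Zz].
  by exists z, Z.
- move=> x y z [X FX Xxyz]; have [_ + _] := FP _ FX => /(_ _ _ _ Xxyz)[].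
  by move=> /domF ? /domF ?; split; auto.
- move=> p q z Xp Xq.
  have [//|//|//|Z [FZ Zx Zy]] := common _ (p, z) (q, z) id.
  by have [_ _ /(_ _ _ _ Zx Zy)] := FP _ FZ.
Qed.

(** Zorn's lemma gives a maximal injective operation on an infinite set [A]. Either the complement
    of [A] embeds in [A], and then so does [K], or [A] embeds in its complement, and the operation
    can be extended. *)
Lemma card_le_square : [set: nat] #<= [set: K] -> [set: K * K] #<= [set: K].
Proof.
move=> natK.
have [k0 _] := card_le_nonempty 0%N natK; have [e [_ einj]] := card_le_injP k0 natK.
(* The pairing function of the naturals, carried to their copy in [K]. *)
pose G0 := [set w | exists i j, w = (e i, e j, e (choice.pickle (i, j)))].
have domG0 x : dom G0 x <-> exists i, x = e i.
  split=> [[y [z [i [j [-> _ _]]]]]|[i ->]]; first by exists i.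
  by exists (e i), (e (choice.pickle (i, i))), i, i.
have G0good : good G0.
  split.
  - move=> x y /domG0[i ->] /domG0[j ->].
    by exists (e (choice.pickle (i, j))), i, j.
  - move=> x y z [i [j [_ -> ->]]]; split; apply/domG0; first by exists j.
    by exists (choice.pickle (i, j)).
  - move=> p q z [i [j [-> ->]]] [i' [j' [-> ]]] /(einj _ _ I I).
    by move=> /(pcan_inj (@choice.pickleK _)) [-> ->].
(* Goodness is asked of the union with [G0], so that the maximal operation has an infinite domain;
   the empty chain then yields [G0] itself. *)
have [F FP Ftot|G [Ggood Gmax]] := @Zorn_bigcup _ (fun G => good (G0 `|` G)).
  have [->|/set0P[X0 FX0]] := eqVneq F set0; first by rewrite bigcup_set0 setU0.
  have -> : G0 `|` \bigcup_(X in F) X = \bigcup_(X in [set G0 `|` Y | Y in F]) X.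
    apply/seteqP; split=> w.
      move=> [G0w|[X FX Xw]]; first by exists (G0 `|` X0); [exists X0|left].
      by exists (G0 `|` X); [exists X|right].
    by move=> [_ [X FX <-]] [G0w|Xw]; [left|right; exists X].
  apply: good_bigcup; first by move=> _ [X FX <-]; exact: FP.
  move=> _ _ [X FX <-] [Y FY <-]; have [XY|YX] := Ftot _ _ FX FY.
    by left; exact: setUS.
  by right; exact: setUS.
set H := G0 `|` G in Ggood; set A := dom H.
have AE i : A (e i) by exists (e i), (e (choice.pickle (i, i))); left; exists i, i.
have Adom x y z : H (x, y, z) -> [/\ A x, A y & A z].
  by case: Ggood => _ + _ Hxyz => /(_ _ _ _ Hxyz)[? ?]; split => //; exists y, z.
have [f [fA finj]] : exists f : K * K -> K,
   (forall p, (A `*` A) p -> A (f p)) /\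
   forall p q, (A `*` A) p -> (A `*` A) q -> f p = f q -> p = q.
  apply: (card_le_injP k0).
  have [Ht _ Hi] := Ggood.
  apply: (@card_le_of_rel _ _ _ _ (fun p z => H (p, z))).
    move=> [x y] [/= Ax Ay]; have [z Hz] := Ht _ _ Ax Ay; exists z => //.
    by case: (Adom _ _ _ Hz).
  by move=> p q z _ _; exact: Hi.
have fA2 x y : A x -> A y -> A (f (x, y)) by move=> Ax Ay; apply: fA.
have finj2 x y x' y' : A x -> A y -> A x' -> A y' -> f (x, y) = f (x', y') ->
    x = x' /\ y = y'.
  by move=> Ax Ay Ax' Ay' /finj E; have [-> ->] : (x, y) = (x', y') by exact: E.
pose s (b : bool) : K := e b.
have sA b : A (s b) by exact: AE.
have sinj b c : s b = s c -> b = c by move=> /(einj _ _ I I); case: b; case: c.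
have [/(card_le_injP k0)[h [hA hinj]]|/(card_le_injP k0)[h [hA hinj]]] :=
    card_le_total (~` A) A.
  (* [p] embeds [K] in [A]: the two tags separate the points of [A] from the images of the other
     points. *)
  pose p x := if pselect (A x) then f (s true, x) else f (s false, h x).
  have pA x : A (p x).
    by rewrite /p; case: pselect => Ax; apply: fA2 => //; exact: hA.
  have pinj x y : p x = p y -> x = y.
    rewrite /p; case: pselect => Ax; case: pselect => Ay E.
    - by have [] := finj2 _ _ _ _ (sA _) Ax (sA _) Ay E.
    - by have [/sinj] := finj2 _ _ _ _ (sA _) Ax (sA _) (hA _ Ay) E.
    - by have [/sinj] := finj2 _ _ _ _ (sA _) (hA _ Ax) (sA _) Ay E.
    - by have [_ /(hinj _ _ Ax Ay)] :=
        finj2 _ _ _ _ (sA _) (hA _ Ax) (sA _) (hA _ Ay) E.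
  apply: (@card_le_of_inj _ _ _ _ (fun w => f (p w.1, p w.2))) => //.
  move=> [x y] [x' y'] _ _ /=.
  by move=> /(finj2 _ _ _ _ (pA _) (pA _) (pA _) (pA _))[/pinj-> /pinj->].
(* Otherwise a copy [h A] of [A] lies outside [A], and the operation extends to
   [A `|` h A] by sending the new pairs into [h A]. *)
exfalso.
pose v (b : bool) x := if b then h x else x.
(* The condition [i || j] singles out the pairs not both of whose entries are in [A]. The value
   encodes the sides [i], [j] together with the underlying points [a], [b]. *)
pose N := [set w | exists i j a b, [/\ A a, A b, i || j &
   w = (v i a, v j b, h (f (f (s i, s j), f (a, b))))]].
apply: (Gmax (G `|` N)).
  split; first exact: subsetUl.
  move=> sub.
  have : A (h (e 0%N)).
    exists (h (e 0%N)), (h (f (f (s true, s true), f (e 0%N, e 0%N)))).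
    by right; apply: sub; right; exists true, true, (e 0%N), (e 0%N); split.
  exact: hA.
rewrite setUA -/H.
have zA i j a b : A a -> A b -> A (f (f (s i, s j), f (a, b))).
  by move=> Aa Ab; exact: fA2 (fA2 _ _ (sA _) (sA _)) (fA2 _ _ Aa Ab).
have domHN x : dom (H `|` N) x <-> exists i a, A a /\ x = v i a.
  split=> [[y [z [Hx|[i [j [a [b [Aa Ab ij [-> _ _]]]]]]]]]|[i [a [Aa ->]]]].
  - by exists false, x; split => //; exists y, z.
  - by exists i, a.
  - case: i; first by exists (h a), (h (f (f (s true, s true), f (a, a)))); right;
      exists true, true, a, a.
    by case: Aa => y [z ?]; exists y, z; left.
split.
- move=> x y /domHN[i [a [Aa ->]]] /domHN[j [b [Ab ->]]].
  have [ij|] := boolP (i || j).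
    by exists (h (f (f (s i, s j), f (a, b)))); right; exists i, j, a, b.
  rewrite negb_or => /andP[/negbTE-> /negbTE->] /=.
  by have [+ _ _] := Ggood => /(_ _ _ Aa Ab)[z Hz]; exists z; left.
- move=> x y z [/Adom[Ax Ay Az]|[i [j [a [b [Aa Ab ij [_ -> ->]]]]]]].
    by split; apply/domHN; [exists false, y|exists false, z].
  split; apply/domHN; first by exists j, b.
  exists true, (f (f (s i, s j), f (a, b))); split => //.
  exact: zA.
- move=> [x y] [x' y'] z.
  move=> [Hp|[i [j [a [b [Aa Ab ij [-> -> ->]]]]]]]
    [Hq|[i' [j' [a' [b' [Aa' Ab' ij' ]]]]]].
  + by have [_ _] := Ggood; apply; [exact: Hp|exact: Hq].
  + move=> [_ _ zE]; have [_ _ Az] := Adom _ _ _ Hp.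
    by have := hA _ (zA i' j' _ _ Aa' Ab'); rewrite -zE.
  + have [_ _ Az] := Adom _ _ _ Hq.
    by have := hA _ (zA i j _ _ Aa Ab).
  + move=> [-> -> /hinj]; move=> /(_ (zA _ _ _ _ Aa Ab) (zA _ _ _ _ Aa' Ab')).
    move=> /(finj2 _ _ _ _ (fA2 _ _ (sA _) (sA _)) (fA2 _ _ Aa Ab)
      (fA2 _ _ (sA _) (sA _)) (fA2 _ _ Aa' Ab')).
    case=> /(finj2 _ _ _ _ (sA _) (sA _) (sA _) (sA _))[/sinj-> /sinj->].
    by move=> /(finj2 _ _ _ _ Aa Ab Aa' Ab')[-> ->].
Qed.

End Square.

(** A point of the union is coded by an index of a set containing it and its code within that set;
    such pairs number at most the square of [K]. *)
Lemma card_le_bigcup {K I T : Type} (D : set I) (F : I -> set T) :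
  [set: nat] #<= [set: K] -> D #<= [set: K] ->
  (forall i, D i -> F i #<= [set: K]) ->
  \bigcup_(i in D) F i #<= [set: K].
Proof.
move=> natK DK FK.
have [k0 _] := card_le_nonempty 0%N natK; have [d [_ dinj]] := card_le_injP k0 DK.
have /choice[f finj] i : exists f : T -> K,
    D i -> forall x y, F i x -> F i y -> f x = f y -> x = y.
  have [/FK/(card_le_injP k0)[f [_ ?]]|nDi] := pselect (D i); first by exists f.
  by exists (fun=> k0).
apply: card_le_trans _ (card_le_square _ natK).
apply: (@card_le_of_rel _ _ _ _
  (fun x p => exists i, [/\ D i, F i x & p = (d i, f i x)])).
  by move=> x [i Di Fx]; exists (d i, f i x) => //; exists i.
move=> x y z _ _ [i [Di Fx ->]] [j [Dj Fy [/dinj ij]]].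
have {}ij : i = j by exact: ij.
by subst j; apply: finj.
Qed.

(** * Interleaving and cylinders in the Cantor space *)

Definition interleave (p : cantor_meas * cantor_meas) : cantor_meas :=
  (fun n => if odd n then p.2 n./2 else p.1 n./2) : cantor_space.

Definition cylinder (J : {fset nat}) (s : nat -> bool) : set cantor_meas :=
  [set x | forall i, i \in J -> x i = s i].

Lemma measurable_coordinate (n : nat) (b : bool) :
  measurable ([set x | x n = b] : set cantor_meas).
Proof. by apply: sub_sigma_algebra; exists n, b. Qed.

Lemma measurable_cylinder J s : measurable (cylinder J s).
Proof.
have -> : cylinder J s =
    \bigcap_(i in [set` J]) [set x : cantor_meas | x i = s i] by [].
by apply: bigcap_measurableType => i _; exact: measurable_coordinate.
Qed.

Lemma measurable_interleave :
  measurable_fun [set: cantor_meas * cantor_meas] interleave.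
Proof.
apply: (@measurability _ _ _ cantor_meas _ _ coordinate_sets) => //.
move=> _ [_ [n [b ->]] <-]; rewrite setTI.
have [no|ne] := boolP (odd n).
  have -> : interleave @^-1` [set x | x n = b] =
      snd @^-1` [set x : cantor_meas | x n./2 = b].
    by rewrite /interleave; apply/seteqP; split => p /=; rewrite no.
  rewrite -[X in measurable X]setTI; apply: measurable_snd => //.
  exact: measurable_coordinate.
have -> : interleave @^-1` [set x | x n = b] =
    fst @^-1` [set x : cantor_meas | x n./2 = b].
  by rewrite /interleave; apply/seteqP; split => p /=; rewrite (negbTE ne).
rewrite -[X in measurable X]setTI; apply: measurable_fst => //.
exact: measurable_coordinate.
Qed.

(** The empty set is included because two cylinders with conflicting prescriptions are disjoint. *)
Definition cylinders : set (set cantor_meas) :=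
  [set A | A = set0 \/ exists J s, A = cylinder J s].

Lemma setI_closed_cylinders : setI_closed cylinders.
Proof.
move=> A B [->|[J [s ->]]]; first by left; rewrite set0I.
move=> [->|[J' [s' ->]]]; first by left; rewrite setI0.
have [->|/set0P[x [xJ xJ']]] := eqVneq (cylinder J s `&` cylinder J' s') set0.
  by left.
(* Any common point [x] satisfies both prescriptions and can serve as the joint one. *)
right; exists (J `|` J')%fset, x; apply/seteqP; split => y /=.
  move=> [yJ yJ'] i; rewrite in_fsetU => /orP[iJ|iJ].
    by rewrite yJ// xJ.
  by rewrite yJ'// xJ'.
move=> yx; split=> i iJ; rewrite yx ?in_fsetU ?iJ ?orbT//; [exact: xJ|exact: xJ'].
Qed.

Lemma measurable_cylinders : @measurable _ cantor_meas = <<s cylinders >>.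
Proof.
apply/seteqP; split.
  apply: sub_sigma_algebra2 => A [n [b ->]]; right.
  exists [fset n]%fset, (fun=> b); apply/seteqP; split => x /=.
    by move=> xn i; rewrite inE => /eqP->.
  by apply; rewrite inE.
apply: smallest_sub; first exact: sigma_algebra_measurable.
move=> _ [->|[J [s ->]]]; [exact: measurable0|exact: measurable_cylinder].
Qed.

(** The coordinates that [J] prescribes to one factor of an interleaved point: to the first for
    [false], to the second for [true]. *)
Definition halves (b : bool) (J : {fset nat}) : {fset nat} :=
  [fset i in [seq i./2 | i <- J & odd i == b]]%fset.

Lemma mem_halves b J i : (i \in halves b J) = (b + i.*2 \in J)%N.
Proof.
rewrite inE /=; apply/mapP/idP => [[j]|bi].
  by rewrite mem_filter => /andP[/eqP <- jJ] ->; rewrite odd_double_half.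
exists (b + i.*2)%N; last by rewrite half_bit_double.
by rewrite mem_filter bi oddD odd_double addbF oddb eqxx.
Qed.

Lemma card_halves J : (#|` halves false J| + #|` halves true J| = #|` J|)%N.
Proof.
have card_half b : #|` halves b J| = count (fun i => odd i == b) J.
  rewrite card_fseq undup_id ?size_map ?size_filter// map_inj_in_uniq.
    exact/filter_uniq/fset_uniq.
  move=> i j; rewrite !mem_filter => /andP[/eqP io _] /andP[/eqP jo _] ij.
  by rewrite -(odd_double_half i) -(odd_double_half j) io jo ij.
rewrite !card_half -[RHS](count_predC (fun i => odd i == false)).
by congr (_ + _)%N; apply: eq_count => i /=; case: odd.
Qed.

Lemma preimage_interleave_cylinder J s : interleave @^-1` cylinder J s =
  cylinder (halves false J) (fun i => s i.*2) `*`
  cylinder (halves true J) (fun i => s i.*2.+1).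
Proof.
apply/seteqP; split => [[x y] /= xyJ|[x y] [/= xJ yJ] i iJ].
  split=> i /=; rewrite mem_halves ?add0n ?add1n => /xyJ; rewrite /interleave/=.
    by rewrite odd_double doubleK.
  by rewrite odd_double /= uphalf_double.
have := mem_halves (odd i) J i./2; rewrite odd_double_half iJ.
rewrite /interleave -[in s i](odd_double_half i).
by case: (odd i) => /=; [apply: yJ | apply: xJ].
Qed.

(** * The product measure: total mass, invariance under interleaving, null lines *)

Lemma product_measure_setT (R : realType)
    (mu : {measure set cantor_meas -> \bar R}) :
  is_product_measure mu -> mu setT = 1%E.
Proof.
(* The whole space is the cylinder over no coordinates. *)
move=> hmu; have := hmu fset0 (fun=> true); rewrite cardfs0 expr0 => <-.
by congr (mu _); apply/seteqP; split.
Qed.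

(* A constant to which the structure of a probability can be attached. *)
Definition product_prob (R : realType) (mu : {measure set cantor_meas -> \bar R})
  of is_product_measure mu : set cantor_meas -> \bar R := mu.

Section product_prob.
Variables (R : realType) (mu : {measure set cantor_meas -> \bar R}).
Hypothesis hmu : is_product_measure mu.

HB.instance Definition _ := Measure.copy (product_prob R mu hmu) mu.
HB.instance Definition _ := Measure_isProbability.Build _ _ _
  (product_prob R mu hmu) (product_measure_setT R mu hmu).
End product_prob.

Section ProductProbability.
Variables (R : realType) (mu : probability cantor_meas R).
Hypothesis hmu : is_product_measure mu.

(** Both measures agree on cylinders, since the exponents of the two halves add up to the size of
    [J], and the cylinders form a generating pi-system. *)
Lemma pushforward_interleave A : measurable A ->
  (mu \x mu)%E (interleave @^-1` A) = mu A.
Proof.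
move=> mA.
have mi := measurable_interleave.
pose h : measure cantor_meas R :=
  @measure_function_pushforward__canonical__measure_function_Measure
    _ _ _ _ _ (mu \x mu)%E _ mi.
apply: (@measure_unique _ _ _ cylinders (fun=> setT) measurable_cylinders
  setI_closed_cylinders _ _ h mu) => //.
- move=> _; right; exists fset0, (fun=> true); by apply/seteqP; split.
- exact: bigcup_const.
- move=> _ [->|[J [s ->]]]; first by rewrite !measure0.
  rewrite /h/= /pushforward preimage_interleave_cylinder product_measure1E;
    [|exact: measurable_cylinder..].
  by rewrite /cylinder !hmu -EFinM -exprD card_halves.
- move=> k; rewrite /h/= /pushforward preimage_setT -setXTT product_measure1E//.
  by rewrite !(product_measure_setT _ mu hmu) -EFinM ltry.
Qed.

(** Fubini: the measure of the sections of a measurable null cover [B] is a nonnegative function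
    with integral zero, hence zero almost everywhere. *)
Lemma negligible_xsection A : mu.-negligible A ->
  mu.-negligible [set z | ~ mu.-negligible [set t | A (interleave (z, t))]].
Proof.
move=> [B [mB muB AB]].
have mI : measurable (interleave @^-1` B).
  by rewrite -[X in measurable X]setTI; exact: measurable_interleave.
have := pushforward_interleave _ mB; rewrite muB /product_measure1 => int0.
have mf := measurable_fun_xsection mu mI.
have [+ _] := ae_eq_integral_abs mu measurableT mf.
have -> : (\int[mu]_x `|(mu \o xsection (interleave @^-1` B)) x| = 0)%E.
  by rewrite -int0; apply: eq_integral => x _;
    rewrite gee0_abs//; exact: measure_ge0.
move=> /(_ erefl) ae0.
apply: negligibleS ae0 => z /= nz /(_ I) mz; apply: nz.
exists (xsection (interleave @^-1` B) z); split => //.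
  exact: measurable_xsection.
by move=> t /AB Bt; rewrite /xsection/= inE.
Qed.

(** Prescribing the first [n] of these coordinates already leaves a cylinder of measure [2^-n]. *)
Lemma negligible_prescribed_coordinates (g : nat -> nat) (z : nat -> bool) :
  injective g -> mu.-negligible [set x : cantor_meas | forall i, x (g i) = z i].
Proof.
move=> ginj; set S := (X in mu.-negligible X).
have [->|/set0P[x0 Sx0]] := eqVneq S set0; first exact: negligible_set0.
pose J n := [fset g i | i in iota 0 n]%fset.
pose C := \bigcap_n cylinder (J n) x0.
have mC : measurable C by apply: bigcapT_measurable => n; exact: measurable_cylinder.
exists C; split => //; last first.
  by move=> x Sx n _ i /imfsetP[j /= _ ->]; rewrite Sx Sx0.
have muC n : (mu C <= (2^-1 ^+ n)%:E)%E.
  have <- : #|` J n| = n by rewrite card_imfset//= undup_id ?iota_uniq// size_iota.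
  rewrite -(hmu (J n) x0) le_measure ?inE//; first exact: measurable_cylinder.
  by move=> x; exact.
apply/eqP; rewrite eq_le measure_ge0 andbT.
have muCfin : mu C \is a fin_num.
  by rewrite ge0_fin_numE// (le_lt_trans (muC 0%N))// ltry.
(* A positive [mu C] would exceed [1/(k+1)] for some [k], whereas [2^-k] is at most [1/(k+1)]. *)
rewrite -(fineK muCfin) lee_fin leNgt; apply/negP => /ltr_add_invr[k].
rewrite add0r ltNge => /negP; apply.
rewrite -lee_fin fineK// (le_trans (muC k))// lee_fin exprVn.
rewrite lef_pV2 ?posrE ?exprn_gt0//.
by rewrite -natrX ler_nat ltn_expl.
Qed.

Lemma negligible_interleavel z : mu.-negligible [set interleave (z, t) | t in setT].
Proof.
apply: negligibleS (negligible_prescribed_coordinates _ z double_inj).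
by move=> _ [t _ <-] i; rewrite /interleave odd_double doubleK.
Qed.

Lemma negligible_interleaver t : mu.-negligible [set interleave (z, t) | z in setT].
Proof.
apply: negligibleS (negligible_prescribed_coordinates (fun i => i.*2.+1) t _).
  by move=> _ [z _ <-] i; rewrite /interleave/= odd_double/= uphalf_double.
by move=> i j [/double_inj].
Qed.
End ProductProbability.

(** * Nicely generated ideals with null lines and a Fubini property *)

Lemma card_lt_sub {T U : Type} (A B : set T) (C : set U) :
  A `<=` B -> card_lt B C -> card_lt A C.
Proof.
move=> AB [BC CB]; split; first exact: card_le_trans (subset_card_le AB) BC.
by move=> CA; apply: CB; exact: card_le_trans CA (subset_card_le AB).
Qed.

Section NicelyGenerated.
Variables (X K L : Type) (N : set (set X)) (br : X * X -> X).
Hypothesis infK : [set: nat] #<= [set: K].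
Hypothesis N_sub : forall A B : set X, B `<=` A -> N A -> N B.
Hypothesis N_setT : ~ N setT.
Hypothesis N_brl : forall z, N [set br (z, t) | t in setT].
Hypothesis N_brr : forall t, N [set br (z, t) | z in setT].
Hypothesis N_fubini : forall A, N A -> N [set z | ~ N [set t | A (br (z, t))]].

Lemma nicely_generated_card_le : nicely_generated K L N -> [set: L] #<= [set: K].
Proof.
move=> [F [[Fcov Ftriv Fn0] _ FN NF]]; apply: contrapT => nLK.
have /choice[block Fblock] x : exists a, F a x.
  by have : [set: X] x by []; rewrite -Fcov => -[a _ Fax]; exists a.
have blockE a x : F a x -> block x = a.
  by move=> Fax; apply: Ftriv => //; exists x; split.
have block_small Y : N Y -> card_lt (block @` Y) [set: K].
  move=> /NF[D DK YD]; apply: card_lt_sub DK => _ [x Yx <-].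
  by have [a Da /blockE ->] := YD _ Yx.
have block_sat D : card_lt D [set: K] -> N (block @^-1` D).
  by move=> /FN; apply: N_sub => x /= Dx; exists (block x).
(* At most [K] null sets cannot cover the space: they meet at most [K] blocks, while every one of
   the [L] blocks is nonempty. *)
have cov (J : Type) (D : set J) (S : J -> set X) : D #<= [set: K] ->
    (forall j, D j -> N (S j)) -> exists x, forall j, D j -> ~ S j x.
  move=> DK SN; apply: contrapT => /forallNP nex; apply: nLK.
  apply: card_le_trans _ (card_le_bigcup D (fun j => block @` S j) infK DK _).
    apply: subset_card_le => a _; have [x Fax] := Fn0 a I.
    have /existsNP[j /not_implyP[Dj /contrapT Sx]] := nex x.
    by exists j => //; exists x => //; exact: blockE.
  by move=> j /SN /block_small[].
pose B z w := [set t | block (br (z, t)) = block (br (w, t))].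
pose C w := [set z | ~ N (B z w)].
have NC w : N (C w).
  (* [B z w] is contained in the section at [z] of the saturation of the line of [w]. *)
  apply: N_sub (N_fubini _ (block_sat _ (block_small _ (N_brl w)))) => z /= nB.
  apply: contra_not nB; apply: N_sub => t /= Bt.
  by exists (br (w, t)) => //; exists t.
pose indep W := forall w w', W w -> W w' -> w <> w' -> N (B w w').
have [A AP Atot|W [Wi Wmax]] := @Zorn_bigcup _ indep.
  move=> w w' [W AW Ww] [W' AW' Ww']; have [s|s] := Atot _ _ AW AW'.
    by apply: (AP _ AW') => //; exact: s.
  by apply: (AP _ AW) => //; exact: s.
(* For [z] in [W] take [w = z], as [B z z] is the whole space; any other [z] almost disjoint from
   all of [W] would contradict maximality. *)
have Wcov z : exists2 w, W w & C w z.
  apply: contrapT => nz.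
  have nWz : ~ W z.
    move=> Wz; apply: nz; exists z => //; apply: contra_not N_setT.
    by apply: N_sub.
  have Bz w : W w -> N (B z w).
    by move=> Ww; apply: contrapT => nB; apply: nz; exists w.
  apply: (Wmax (W `|` [set z])).
    by split; [exact: subsetUl|move=> /(_ z) h; apply: nWz; apply: h; right].
  move=> w w' [Ww|->] [Ww'|->] // ww'; [exact: Wi| |exact: Bz].
  by apply: N_sub (Bz _ Ww) => t /=.
(* The empty family does not cover [X], which provides a default point. *)
have [x0 _] : exists x : X, forall j : void, [set: void] j -> ~ set0 x.
  by apply: cov => [|[]]; apply: (@card_le_of_rel _ _ _ _ (fun _ _ => True)) => -[].
have nWK : ~ (W #<= [set: K]).
  move=> WK; have [x xW] := cov _ W C WK (fun w _ => NC w).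
  by have [w Ww /xW] := Wcov x; exact.
have [//|/(card_le_injP x0)[g [gW ginj]]] := card_le_total W [set: K].
(* A height at which the lines [g k] lie in pairwise distinct blocks; the pairs to be avoided number
   at most [K]. *)
have [t tB] := cov _ [set p : K * K | p.1 <> p.2] (fun p => B (g p.1) (g p.2))
  (card_le_trans (card_leT _) (card_le_square _ infK))
  (fun p kk' => Wi _ _ (gW _ I) (gW _ I) (contra_not (ginj _ _ I I) kk')).
(* The transversal line at height [t] is null, so it meets fewer than [K] blocks, yet [k] is
   determined by the block of [br (g k, t)]. *)
have [_] := block_small _ (N_brr t); apply.
apply: (@card_le_of_inj _ _ _ _ (fun k => block (br (g k, t)))).
  by move=> k _; exists (br (g k, t)) => //; exists (g k).
move=> k k' _ _ kk'; apply: contrapT => nkk'.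
exact: tB (k, k') nkk' kk'.
Qed.
End NicelyGenerated.

(** * The null ideal of the Cantor space *)

Theorem mainTheorem2 (R : realType) (mu : {measure set cantor_meas -> \bar R})
  (hmu : is_product_measure mu)
  (Omega1 K L : Type) (hOmega1 : is_omega1 Omega1)
  (hK : [set: Omega1] #<= [set: K])
  (hKL : [set: K] #<= [set: L])
  (hL : [set: L] #<= [set: cantor_space])
  (hN : nicely_generated K L (null_ideal mu)) :
  [set: K] #= [set: L].
Proof.
apply: Cantor_Bernstein => //.
pose P : probability cantor_meas R := product_prob R mu hmu.
have hP : is_product_measure P := hmu.
have infK : [set: nat] #<= [set: K].
  by case: hOmega1 => -[natO _] _; exact: card_le_trans natO hK.
apply: (@nicely_generated_card_le cantor_space K L (null_ideal mu) interleave
  infK _ _ _ _ _ hN).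
- by move=> A B; exact: (@negligibleS _ _ _ mu).
- move=> /(negligibleP mu measurableT) mu0.
  have /eqP := etrans (esym (product_measure_setT R mu hmu)) mu0.
  by rewrite onee_eq0.
- exact: (negligible_interleavel R P hP).
- exact: (negligible_interleaver R P hP).
- exact: (negligible_xsection R P hP).
Qed.
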